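(* Let $\theta\in S^{n-1}$, let $H=\theta^\perp=\{x\in\mathbb R^n:\langle x,\theta\rangle=0\}$, and let $K=P_H B_\infty^n$ be the orthogonal projection of $B_\infty^n$ onto the hyperplane $H$. If $X$ is a random vector uniformly distributed on $K$, then for any two orthonormal vectors $\eta_1,\eta_2\in H$ we have $$\mathbb E\,\langle X,\eta_1\rangle^2\langle X,\eta_2\rangle^2\le \mathbb E\langle X,\eta_1\rangle^2\;\mathbb E\langle X,\eta_2\rangle^2 .$$ Consequently, $X$ satisfies the square negative correlation property with respect to any orthonormal basis of $H$.
   Context: $B_\infty^n=[-1,1]^n$ is the unit ball of $\ell_\infty^n$, $S^{n-1}$ is the Euclidean unit sphere of $\mathbb R^n$, and $P_H$ is the orthogonal projection onto $H$. ''Uniformly distributed on $K$'' refers to $(n-1)$-dimensional Lebesgue measure on $H$. A centered random vector $X$ in a Euclidean space satisfies the square negative correlation property with respect to an orthonormal basis $\{\eta_i\}$ of that space if $\mathbb E\langle X,\eta_i\rangle^2\langle X,\eta_j\rangle^2\le \mathbb E\langle X,\eta_i\rangle^2\,\mathbb E\langle X,\eta_j\rangle^2$ for every $i\ne j$. *)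

(* Defs.v *)
From HB Require Import structures.
From mathcomp Require Import all_boot all_order all_algebra.
From mathcomp Require Import all_classical all_reals all_analysis.

Set Implicit Arguments.
Unset Strict Implicit.
Unset Printing Implicit Defensive.

Import Order.TTheory GRing.Theory Num.Theory.
Import numFieldNormedType.Exports.

Local Open Scope classical_set_scope.
Local Open Scope ring_scope.

(* Row vectors carry the product sigma-algebra, generated by the coordinates,
   exactly as [n.-tuple T] does in the library; over a [realType] this is the
   Borel sigma-algebra of R^n. *)
Section measurable_rV.
Context {d : measure_display} {T : measurableType d}.
Variable n : nat.

Let coords (i : 'I_n) (x : 'rV[T]_n) : T := x ord0 i.

Let rV_set0 : g_sigma_preimage coords set0.
Proof. exact: sigma_algebra0. Qed.

Let rV_setC A : g_sigma_preimage coords A -> g_sigma_preimage coords (~` A).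
Proof. exact: sigma_algebraC. Qed.

Let rV_bigcup (F : _^nat) : (forall i, g_sigma_preimage coords (F i)) ->
  g_sigma_preimage coords (\bigcup_i (F i)).
Proof. exact: sigma_algebra_bigcup. Qed.

HB.instance Definition _ := @isMeasurable.Build (measure_tuple_display d)
  'rV[T]_n (g_sigma_preimage coords) rV_set0 rV_setC rV_bigcup.

End measurable_rV.

Lemma measurable_coord_rV d (T : measurableType d) n (i : 'I_n) :
  measurable_fun [set: 'rV[T]_n] (fun x : 'rV[T]_n => x ord0 i).
Proof.
move=> _ Y mY; rewrite setTI; apply: sub_sigma_algebra => /=.
rewrite -bigcup_seq/=; exists i => /=; first by rewrite mem_index_enum.
by exists Y => //; rewrite setTI.
Qed.

Lemma measurable_fun_rVP d1 d2 (T1 : measurableType d1)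
    (T2 : measurableType d2) n (f : T1 -> 'rV[T2]_n) :
  measurable_fun [set: T1] f <->
  forall i, measurable_fun [set: T1] (fun x => f x ord0 i).
Proof.
split=> [mf i|mf].
  apply: (@measurableT_comp _ _ _ _ _ _ (fun x : 'rV[T2]_n => x ord0 i)) => //.
  exact: measurable_coord_rV.
have H : g_sigma_preimage (fun i (x : T1) => f x ord0 i) `<=` measurable.
  apply: smallest_sub; first exact: sigma_algebra_measurable.
  rewrite -bigcup_seq/=; apply: bigcup_sub => i _.
  by move=> A [B mB <-]; exact: mf.
move=> _ A mA; apply: H.
have := @g_sigma_preimage_comp _ T2 n 'rV[T2]_n (fun i x => x ord0 i) _ f.
by rewrite /comp => ->; exists A.
Qed.

Section lebesgue_rV.
Context {R : realType}.

Definition cons_rV n (p : R * 'rV[R]_n) : 'rV[R]_n.+1 := row_mx p.1%:M p.2.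

Lemma measurable_cons_rV n : measurable_fun setT (@cons_rV n).
Proof.
apply/measurable_fun_rVP => i.
case: (@split_ordP 1 n i) => j ->.
  apply: (eq_measurable_fun (fst : R * 'rV[R]_n -> R)) => //.
  by move=> x _; rewrite /cons_rV (@row_mxEl _ 1 1 n) (ord1 j) mxE eqxx mulr1n.
apply: (eq_measurable_fun (fun x : R * 'rV[R]_n => x.2 ord0 j)).
  by move=> x _; rewrite /cons_rV (@row_mxEr _ 1 1 n).
apply: (@measurableT_comp _ _ _ _ _ _ (fun x : 'rV[R]_n => x ord0 j)) => //.
exact: measurable_coord_rV.
Qed.

Definition uncons_rV n (x : 'rV[R]_n.+1) : R * 'rV[R]_n :=
  (x ord0 ord0, \row_j x ord0 (lift ord0 j)).

Lemma cons_rVK n : cancel (@cons_rV n) (@uncons_rV n).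
Proof.
move=> [a x]; rewrite /uncons_rV /cons_rV /=; congr pair.
  rewrite (_ : ord0 = lshift n (ord0 : 'I_1)); last exact/val_inj.
  by rewrite (@row_mxEl _ 1 1 n) mxE eqxx mulr1n.
apply/rowP => j; rewrite mxE (_ : lift ord0 j = rshift 1 j); last exact/val_inj.
by rewrite (@row_mxEr _ 1 1 n).
Qed.

Lemma measurable_uncons_rV n : measurable_fun setT (@uncons_rV n).
Proof.
apply: measurable_fun_pair; first exact: measurable_coord_rV.
apply/measurable_fun_rVP => i.
apply: (eq_measurable_fun (fun x : 'rV[R]_n.+1 => x ord0 (lift ord0 i))).
  by move=> x _; rewrite mxE.
exact: measurable_coord_rV.
Qed.

Section step.
Variables (n : nat) (mu : {sigma_finite_measure set 'rV[R]_n -> \bar R}).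

Definition lebesgue_step : set 'rV[R]_n.+1 -> \bar R :=
  pushforward (@lebesgue_measure R \x mu)%E (@cons_rV n).

Let step0 : lebesgue_step set0 = 0%E.
Proof. by rewrite /lebesgue_step /pushforward preimage_set0 measure0. Qed.

Let step_ge0 A : (0 <= lebesgue_step A)%E.
Proof. by rewrite /lebesgue_step /pushforward measure_ge0. Qed.

Let step_sigma_additive : semi_sigma_additive lebesgue_step.
Proof.
move=> F mF tF mUF; rewrite /lebesgue_step /pushforward preimage_bigcup.
apply: measure_semi_sigma_additive.
- by move=> k; rewrite -[X in measurable X]setTI; exact: measurable_cons_rV.
- apply/trivIsetP => /= i j _ _ ij; rewrite -preimage_setI.
  by move/trivIsetP : tF => /(_ _ _ _ _ ij) ->//; rewrite preimage_set0.
- rewrite -preimage_bigcup -[X in measurable X]setTI.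
  exact: measurable_cons_rV.
Qed.

HB.instance Definition _ := isMeasure.Build _ _ _ lebesgue_step
  step0 step_ge0 step_sigma_additive.

Let step_sigma_finite : sigma_finite setT lebesgue_step.
Proof.
have /sigma_finiteP[F [TF ndF Foo]] :=
  sigma_finiteT (lebesgue_stieltjes_measure (@idfun R)).
have /sigma_finiteP[G [TG ndG Goo]] := sigma_finiteT mu.
exists (fun k => @uncons_rV n @^-1` (F k `*` G k)).
  rewrite -preimage_bigcup (_ : \bigcup_k _ = setT) ?preimage_setT//.
  apply/seteqP; split=> // -[x y] _.
  have [k _ Fkx] : (\bigcup_k F k) x by rewrite -TF.
  have [l _ Gly] : (\bigcup_k G k) y by rewrite -TG.
  exists (maxn k l) => //; split.
  - by move: x Fkx; exact/subsetPset/ndF/leq_maxl.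
  - by move: y Gly; exact/subsetPset/ndG/leq_maxr.
move=> k; have [mFk Fkoo] := Foo k; have [mGk Gkoo] := Goo k; split.
  rewrite -[X in measurable X]setTI; apply: measurable_uncons_rV => //.
  exact: measurableX.
rewrite /lebesgue_step /pushforward -comp_preimage.
rewrite (_ : _ \o _ = id); last by apply/funext => p; exact: cons_rVK.
rewrite preimage_id product_measure1E//.
by rewrite lte_mul_pinfty// ge0_fin_numE.
Qed.

HB.instance Definition _ := Measure_isSigmaFinite.Build _ _ _ lebesgue_step
  step_sigma_finite.

End step.

(* n-dimensional Lebesgue measure; the one-point space R^0 has measure 1. *)
Fixpoint lebesgue_rV n : {sigma_finite_measure set 'rV[R]_n -> \bar R} :=
  match n with
  | 0 => dirac (0 : 'rV[R]_0)
  | n'.+1 => lebesgue_step (lebesgue_rV n')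
  end.

End lebesgue_rV.

Section euclidean.
Context {R : realType} {n : nat}.
Implicit Types (x y : 'rV[R]_n) (H A K : set 'rV[R]_n).

Definition dot x y : R := \sum_i x ord0 i * y ord0 i.

(* The norm of the library on matrices is the sup norm. *)
Definition enorm x : R := Num.sqrt (dot x x).

Definition unit_sphere : set 'rV[R]_n := [set x | enorm x = 1].

Definition orthogonal_hyperplane (theta : 'rV[R]_n) : set 'rV[R]_n :=
  [set x | dot x theta = 0].

Definition Binfty : set 'rV[R]_n := [set x | forall i, -1 <= x ord0 i <= 1].

Definition is_orthogonal_projection H x y :=
  H y /\ forall z, H z -> dot (x - y) z = 0.

Definition projection_image H A : set 'rV[R]_n :=
  [set y | exists2 x, A x & is_orthogonal_projection H x y].

Definition from_coords m (e : 'I_m -> 'rV[R]_n) (v : 'rV[R]_m) : 'rV[R]_n :=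
  \sum_i v ord0 i *: e i.

Definition orthonormal_basis H m (e : 'I_m -> 'rV[R]_n) :=
  [/\ forall i, H (e i),
      forall i j, dot (e i) (e j) = (i == j)%:R
    & forall x, H x -> exists v : 'rV[R]_m, x = from_coords e v].

(* Lebesgue measure on the span of an orthonormal family e : 'I_m -> R^n, that
   is, m-dimensional Lebesgue measure transported by the linear isometry
   R^m -> span e given by e. *)
Definition lebesgue_span m (e : 'I_m -> 'rV[R]_n) : set 'rV[R]_n -> \bar R :=
  pushforward (lebesgue_rV m) (from_coords e).

(* By rotation invariance [lebesgue_span e] is the same measure for all
   orthonormal bases e of H, so it does not matter which one is used here. *)
Definition uniformly_distributed m H K d (T : measurableType d)
    (P : probability T R) (X : {RV P >-> 'rV[R]_n}) :=
  exists2 e : 'I_m -> 'rV[R]_n, orthonormal_basis H e &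
    forall A, measurable A ->
      distribution P X A = (lebesgue_span e (A `&` K) / lebesgue_span e K)%E.

Definition centered d (T : measurableType d) (P : probability T R)
    (X : {RV P >-> 'rV[R]_n}) :=
  forall i, ('E_P[fun w => X w ord0 i] = 0)%E.

Definition square_negative_correlation d (T : measurableType d)
    (P : probability T R) (X : {RV P >-> 'rV[R]_n}) m
    (eta : 'I_m -> 'rV[R]_n) :=
  centered X /\
  forall i j, i != j ->
    ('E_P[fun w => (dot (X w) (eta i) ^+ 2 * dot (X w) (eta j) ^+ 2)%R]
     <= 'E_P[fun w => (dot (X w) (eta i) ^+ 2)%R]
        * 'E_P[fun w => (dot (X w) (eta j) ^+ 2)%R])%E.

End euclidean.

Arguments Binfty {R n}.
Arguments unit_sphere {R n}.
Arguments uniformly_distributed {R n} m H K {d T P} X.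

(* Main.v *)
Require Import Defs.
From HB Require Import structures.
From mathcomp Require Import all_boot all_order all_algebra fingroup perm.
From mathcomp Require Import all_classical all_reals all_analysis.
From mathcomp Require Import measurable_realfun ring lra.

Set Implicit Arguments.
Unset Strict Implicit.
Unset Printing Implicit Defensive.

Import Order.TTheory GRing.Theory Num.Theory.
Import numFieldNormedType.Exports.

Local Open Scope classical_set_scope.
Local Open Scope ring_scope.

(** Move a point of the cube [-1, 1]^n in direction [theta] until it leaves the
    cube: it does so through a facet [x_i = sgn theta_i], and through exactly
    one of them once ties are broken.  Hence [K] is tiled by the projections of
    these facets.  Projecting the [i]-th facet onto [H] multiplies volumes by
    [|theta_i|], so that [X] has the law of the projection of [Y], where [Y] is
    uniform on a facet chosen at random, the [i]-th one with probability
    [w_i = |theta_i| / sum_j |theta_j|].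

    For [eta] in [H] the projection does not change [<Y, eta>], and the
    coordinates of [Y] are independent: one of them is a sign and the other
    ones are uniform on [-1, 1].  With [p = sum_i w_i a_i^2] and
    [q = sum_i w_i b_i^2], the moments of such a [Y] give, for orthonormal
    [a] and [b] in [H],
      [E <X,a>^2 = 1/3 + 2/3 p], [E <X,b>^2 = 1/3 + 2/3 q] and
      [E <X,a>^2 <X,b>^2 = 1/9 + 2/9 (p + q) - 8/15 sum_i w_i a_i^2 b_i^2
                           - 2/15 sum_i a_i^2 b_i^2],
    while the product of the first two is [1/9 + 2/9 (p + q) + 4/9 p q].

    The volume factor [|theta_i|] is obtained without determinants.  Let [C_i]
    be the cylinder in direction [theta] over the [i]-th facet, and cut from it
    the slab of the points whose travel time from the facet lies in ]0, 1].
    For an integrand that is constant along [theta], slicing the slab in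
    direction [theta] gives the integral over the projected facet, whereas
    slicing it along the [i]-th axis gives [|theta_i|] times the integral over
    the facet ([integral_slab]).  The two computations use different orthonormal
    systems; [integral_comp_affine] says that passing from one to the other
    rescales all integrals by one and the same constant.  That constant does not
    depend on [i], so it disappears when dividing by the volume of [K], and its
    value is never computed. *)

(** * Scalar product *)

Section scalar_product.
Context {R : realType} {n : nat}.
Implicit Types x y a : 'rV[R]_n.

Lemma dotC x a : dot x a = dot a x.
Proof. by apply: eq_bigr => i _; rewrite mulrC. Qed.

Lemma dotDl x y a : dot (x + y) a = dot x a + dot y a.
Proof.
by rewrite /dot -big_split; apply: eq_bigr => i _; rewrite mxE mulrDl.
Qed.

Lemma dotZl s x a : dot (s *: x) a = s * dot x a.
Proof. by rewrite /dot mulr_sumr; apply: eq_bigr => i _; rewrite mxE mulrA. Qed.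

Lemma dot0l a : dot 0 a = 0.
Proof. by rewrite /dot big1// => i _; rewrite mxE mul0r. Qed.

Lemma dot0r x : dot x 0 = 0.
Proof. by rewrite dotC dot0l. Qed.

Lemma dot_suml (I : finType) (f : I -> 'rV[R]_n) a :
  dot (\sum_i f i) a = \sum_i dot (f i) a.
Proof.
rewrite /dot exchange_big; apply: eq_bigr => j _.
by rewrite summxE mulr_suml.
Qed.

Lemma dot_ge0 x : 0 <= dot x x.
Proof. by apply: sumr_ge0 => i _; rewrite -expr2 sqr_ge0. Qed.

Lemma dot_eq0 x : dot x x = 0 -> x = 0.
Proof.
move=> /eqP; rewrite psumr_eq0 => [/allP x0|i _]; last first.
  by rewrite -expr2 sqr_ge0.
apply/rowP => i; have := x0 i (mem_index_enum _).
by rewrite mxE mulf_eq0 orbb => /eqP.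
Qed.

Lemma measurable_dot a : measurable_fun setT (dot ^~ a).
Proof.
apply: measurable_sum => i; apply: measurable_funM => //.
exact: measurable_coord_rV.
Qed.

End scalar_product.

(** * Fubini and translation invariance in R^n *)

Section lebesgue_invariance.
Context {R : realType}.

Lemma integral_lebesgue_translate (z : R) (f : R -> \bar R) :
  measurable_fun [set: R] f -> (forall x, 0 <= f x)%E ->
  (\int[@lebesgue_measure R]_x f (x + z)%R = \int[@lebesgue_measure R]_x f x)%E.
Proof.
move=> mf f0.
pose shift (x : measurableTypeR R) : measurableTypeR R := x + z.
have mz : measurable_fun setT shift by exact: measurable_funD.
transitivity (\int[pushforward (@lebesgue_measure R) shift]_x f x)%E.
  by rewrite ge0_integral_pushforward.
apply: eq_measure_integral => A mA _; apply/esym.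
apply: lebesgue_measure_unique => // _ [[a b] _ <-] /=.
rewrite /pushforward.
rewrite (_ : _ @^-1` _ = `]a - z, b - z]%classic); last first.
  by apply/seteqP; split => x /=; rewrite !in_itv/= ltrBlDr lerBrDr.
rewrite !lebesgue_measure_itv/= !lte_fin ltrD2r; case: ifP => // _.
by rewrite -!EFinB; congr EFin; ring.
Qed.

Lemma integral_lebesgue_rVS n (f : 'rV[R]_n.+1 -> \bar R) :
  measurable_fun setT f -> (forall x, 0 <= f x)%E ->
  (\int[lebesgue_rV n.+1]_x f x =
   \int[@lebesgue_measure R]_t \int[lebesgue_rV n]_v f (cons_rV (t, v)))%E.
Proof.
move=> mf f0 /=.
have mf' : measurable_fun setT (f \o @cons_rV R n).
  by apply: measurableT_comp => //; exact: measurable_cons_rV.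
rewrite ge0_integral_pushforward//; last exact: measurable_cons_rV.
by rewrite preimage_setT fubini_tonelli1 // => x; exact: f0.
Qed.

Lemma measurable_fun_section n (f : 'rV[R]_n.+1 -> \bar R) :
  measurable_fun setT f -> (forall x, 0 <= f x)%E ->
  measurable_fun [set: R] (fun t => \int[lebesgue_rV n]_v f (cons_rV (t, v)))%E.
Proof.
move=> mf f0.
have mf' : measurable_fun setT (f \o @cons_rV R n).
  by apply: measurableT_comp => //; exact: measurable_cons_rV.
have f0' x : (0 <= (f \o @cons_rV R n) x)%E by exact: f0.
exact: (measurable_fun_fubini_tonelli_F (m2 := lebesgue_rV n) _ mf' f0').
Qed.

Lemma integral_lebesgue_rVS_swap n (f : 'rV[R]_n.+1 -> \bar R) :
  measurable_fun setT f -> (forall x, 0 <= f x)%E ->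
  (\int[lebesgue_rV n.+1]_x f x =
   \int[lebesgue_rV n]_v \int[@lebesgue_measure R]_t f (cons_rV (t, v)))%E.
Proof.
move=> mf f0; rewrite integral_lebesgue_rVS//.
have mf' : measurable_fun setT (f \o @cons_rV R n).
  by apply: measurableT_comp => //; exact: measurable_cons_rV.
have f0' x : (0 <= (f \o @cons_rV R n) x)%E by exact: f0.
exact: (fubini_tonelli (m1 := @lebesgue_measure R) (m2 := lebesgue_rV n)
          _ mf' f0').
Qed.

Lemma measurable_addr_rV n (z : 'rV[R]_n) :
  measurable_fun setT (fun x : 'rV[R]_n => x + z).
Proof.
apply/measurable_fun_rVP => i; under eq_fun do rewrite mxE.
apply: measurable_funD => //; exact: measurable_coord_rV.
Qed.

Lemma cons_rV0 n (t : R) (v : 'rV[R]_n) : cons_rV (t, v) ord0 ord0 = t.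
Proof. by have /(congr1 fst) := cons_rVK (t, v). Qed.

Lemma cons_rVS n (t : R) (v : 'rV[R]_n) j :
  cons_rV (t, v) ord0 (lift ord0 j) = v ord0 j.
Proof. by have /(congr1 snd)/rowP/(_ j) := cons_rVK (t, v); rewrite mxE. Qed.

Lemma uncons_rVK n (x : 'rV[R]_n.+1) : cons_rV (uncons_rV x) = x.
Proof.
apply/rowP => i; have [j ->|->] := unliftP ord0 i.
  by rewrite /uncons_rV cons_rVS mxE.
by rewrite /uncons_rV cons_rV0.
Qed.

Lemma cons_rVD n (t s : R) (v w : 'rV[R]_n) :
  cons_rV (t, v) + cons_rV (s, w) = cons_rV (t + s, v + w).
Proof.
apply/rowP => i; have [j ->|->] := unliftP ord0 i.
  by rewrite mxE !cons_rVS mxE.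
by rewrite mxE !cons_rV0.
Qed.

Lemma integral_lebesgue_rV_translate n (z : 'rV[R]_n) (f : 'rV[R]_n -> \bar R) :
  measurable_fun setT f -> (forall x, 0 <= f x)%E ->
  (\int[lebesgue_rV n]_x f (x + z)%R = \int[lebesgue_rV n]_x f x)%E.
Proof.
elim: n z f => [|n IH] z f mf f0.
  by apply: eq_integral => x _; rewrite [x + z]thinmx0 [x]thinmx0.
have mfz : measurable_fun setT (fun x : 'rV[R]_n.+1 => f (x + z)).
  by apply: (measurableT_comp mf); exact: measurable_addr_rV.
rewrite (integral_lebesgue_rVS mfz)// (integral_lebesgue_rVS mf)//.
have {1}-> : z = cons_rV (uncons_rV z) by rewrite uncons_rVK.
under eq_integral => t _.
  under eq_integral do rewrite cons_rVD.
  rewrite (IH _ (fun v => f (cons_rV (t + (uncons_rV z).1, v)%R))) //;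
    last first.
    apply: (measurableT_comp mf).
    apply: (measurableT_comp (@measurable_cons_rV _ _)).
    exact: pair1_measurable.
  over.
rewrite /=.
rewrite (@integral_lebesgue_translate _
  (fun t => \int[lebesgue_rV n]_v f (cons_rV (t, v))))%E//.
- exact: measurable_fun_section.
- by move=> t; apply: integral_ge0.
Qed.

End lebesgue_invariance.

(** * Fourth moments of the cube *)

Section cube_moments.
Context {R : realType}.

Lemma integral_poly (P Q : {poly R}) (a b : R) : a < b -> Q^`() = P ->
  (\int[@lebesgue_measure R]_(t in `[a, b]) (P.[t])%:E =
   (Q.[b] - Q.[a])%:E)%E.
Proof.
move=> ab QP; rewrite (@continuous_FTC2 _ _ (horner Q))//.
- by apply/continuous_subspaceT; exact: continuous_horner.
- split=> [x _||]; first exact: derivable_horner.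
  + by apply: cvg_at_right_filter; exact: continuous_horner.
  + by apply: cvg_at_left_filter; exact: continuous_horner.
- by move=> x _; rewrite -derivE QP.
Qed.

(** Ties between facets are broken by removing from a facet the part that it
    shares with the facets of smaller index.  This removes one endpoint from
    some of the intervals whose product the facet is, which leaves all
    integrals unchanged. *)
Definition punctured_interval (r : R) : set R :=
  [set t | -1 <= t <= 1 /\ t != r].

Lemma punctured_intervalE r : punctured_interval r = `[-1, 1] `\ r.
Proof.
apply/seteqP; split => t; rewrite /punctured_interval /= in_itv /=.
  by move=> [-> /eqP].
by move=> [-> /eqP].
Qed.

Lemma measurable_punctured_interval r : measurable (punctured_interval r).
Proof. by rewrite punctured_intervalE; exact: measurableD. Qed.

Lemma integral_quartic (r c0 c1 c2 c3 c4 : R) :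
  (\int[@lebesgue_measure R]_t (\1_(punctured_interval r) t *
      (c0 + c1 * t + c2 * t ^+ 2 + c3 * t ^+ 3 + c4 * t ^+ 4))%:E =
   (2 * (c0 + c2 / 3 + c4 / 5))%:E)%E.
Proof.
pose P : {poly R} := Poly [:: c0; c1; c2; c3; c4].
pose Q : {poly R} := Poly [:: 0; c0; c1 / 2; c2 / 3; c3 / 4; c4 / 5].
have QP : Q^`() = P.
  apply/polyP => i; rewrite coef_deriv !coef_Poly.
  case: i => [|[|[|[|[|i]]]]] /=; rewrite ?mulr1n //.
  1-4: by field.
  by rewrite !nth_nil mul0rn.
transitivity
    (\int[@lebesgue_measure R]_(t in `[(-1)%R, 1%R] `\ r) (P.[t])%:E)%E.
  rewrite [RHS]integral_mkcond; apply: eq_integral => t _.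
  rewrite epatch_indic /= -punctured_intervalE -EFinM mulrC; congr EFin.
  by rewrite horner_Poly /=; ring.
rewrite integral_setD1; last first.
- by apply/measurable_EFinP; exact: pi_irrational.measurable_poly.
- exact: measurableD.
rewrite (integral_poly _ QP) ?gtrN// !horner_Poly /=; congr EFin.
by field.
Qed.

Lemma dot_cons n t (v : 'rV[R]_n) (a : 'rV[R]_n.+1) :
  dot (cons_rV (t, v)) a = t * a ord0 ord0 + dot v (uncons_rV a).2.
Proof.
rewrite /dot big_ord_recl cons_rV0; congr (_ + _).
by apply: eq_bigr => i _; rewrite cons_rVS mxE.
Qed.

Lemma dotS n (a b : 'rV[R]_n.+1) :
  dot a b = a ord0 ord0 * b ord0 ord0 + dot (uncons_rV a).2 (uncons_rV b).2.
Proof. by rewrite -{1}[a]uncons_rVK dot_cons. Qed.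

Definition punctured_cube n (r : 'I_n -> R) : set 'rV[R]_n :=
  [set x | forall i, punctured_interval (r i) (x ord0 i)].

Lemma measurable_punctured_cube n (r : 'I_n -> R) :
  measurable (punctured_cube r).
Proof.
rewrite (_ : punctured_cube r =
  \bigcap_(i in [set: 'I_n])
    ((fun x : 'rV[R]_n => x ord0 i) @^-1` punctured_interval (r i))).
  apply: fin_bigcap_measurable => // i _; rewrite -[X in measurable X]setTI.
  by apply: measurable_coord_rV => //; exact: measurable_punctured_interval.
by apply/seteqP; split => x /= h i; [move=> _|]; exact: h.
Qed.

Lemma indic_punctured_cubeS n (r : 'I_n.+1 -> R) t (v : 'rV[R]_n) :
  \1_(punctured_cube r) (cons_rV (t, v)) =
  \1_(punctured_interval (r ord0)) t *
  \1_(punctured_cube (fun j => r (lift ord0 j))) v :> R.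
Proof.
rewrite !indicE -natrM mulnb; congr (nat_of_bool _)%:R.
apply/idP/andP; rewrite !inE.
  move=> h; split; first by have := h ord0; rewrite cons_rV0.
  by move=> j; have := h (lift ord0 j); rewrite cons_rVS.
move=> [h0 h] i; have [j ->|->] := unliftP ord0 i; last by rewrite cons_rV0.
by rewrite cons_rVS.
Qed.

(** The constants [c] and [d] make the family closed under fixing a coordinate,
    and let it contain [1] and [<x, a>^2] besides [<x, a>^2 <x, b>^2]. *)
Definition quartic n (c : R) (a : 'rV[R]_n) (d : R) (b : 'rV[R]_n) x :=
  (c + dot x a) ^+ 2 * (d + dot x b) ^+ 2.

Lemma quartic_ge0 n c (a : 'rV[R]_n) d b x : 0 <= quartic c a d b x.
Proof. by rewrite mulr_ge0// sqr_ge0. Qed.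

Lemma measurable_quartic n c (a : 'rV[R]_n) d b :
  measurable_fun setT (quartic c a d b).
Proof.
by apply: measurable_funM; apply: measurable_funX; apply: measurable_funD => //;
  exact: measurable_dot.
Qed.

Lemma measurable_indic_quartic n (r : 'I_n -> R) c a d b :
  measurable_fun setT
    (fun x => (\1_(punctured_cube r) x * quartic c a d b x)%:E).
Proof.
apply/measurable_EFinP/measurable_funM; last exact: measurable_quartic.
by apply: measurable_indic; exact: measurable_punctured_cube.
Qed.

(** The mean of [quartic c a d b] over the cube.  For [U = <x, a>] and
    [V = <x, b>] with independent coordinates of variance 1/3 one has
    [E U^2 V^2 = E U^2 E V^2 + 2 (E U V)^2 + k sum_i a_i^2 b_i^2], where
    [k = 1/5 - 3 (1/3)^2 = -2/15] is the fourth cumulant of a coordinate. *)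
Definition quartic_mean n (c : R) (a : 'rV[R]_n) (d : R) (b : 'rV[R]_n) :=
  (c ^+ 2 + dot a a / 3) * (d ^+ 2 + dot b b / 3)
  + 4 * c * d * (dot a b / 3) + 2 * (dot a b / 3) ^+ 2
  - 2 / 15 * \sum_i a ord0 i ^+ 2 * b ord0 i ^+ 2.

(** Induction on [n]: once the first coordinate [t] is fixed, the integrand is a
    [quartic] in the other ones with constants [c + t a_0] and [d + t b_0], and
    its mean is a polynomial of degree 4 in [t]. *)
Lemma integral_punctured_cube n (r : 'I_n -> R) c a d b :
  (\int[lebesgue_rV n]_x (\1_(punctured_cube r) x * quartic c a d b x)%:E =
   (2 ^+ n * quartic_mean c a d b)%:E)%E.
Proof.
elim: n r c a d b => [|n IH] r c a d b.
  rewrite integral_dirac//; last exact: measurable_indic_quartic.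
  rewrite diracT mul1e /quartic /quartic_mean /dot !big_ord0 indicE.
  rewrite mem_set; last by case.
  by congr EFin; rewrite !mul0r expr0n !(addr0, mulr0, subr0) expr0.
rewrite integral_lebesgue_rVS; last 2 first.
- exact: measurable_indic_quartic.
- by move=> x; rewrite lee_fin mulr_ge0// quartic_ge0.
set a' := (uncons_rV a).2; set b' := (uncons_rV b).2.
have slice t v :
    (\1_(punctured_cube r) (cons_rV (t, v)) *
     quartic c a d b (cons_rV (t, v)))%:E =
      ((\1_(punctured_interval (r ord0)) t)%:E *
       (\1_(punctured_cube (fun j => r (lift ord0 j))) v *
        quartic (c + t * a ord0 ord0) a' (d + t * b ord0 ord0) b' v)%:E)%E.
  by rewrite indic_punctured_cubeS /quartic !dot_cons !addrA -mulrA -EFinM.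
under eq_integral => t _.
  under eq_integral do rewrite slice.
  rewrite ge0_integralZl//; last 2 first.
  - exact: measurable_indic_quartic.
  - by move=> v _; rewrite lee_fin mulr_ge0// quartic_ge0.
  rewrite IH -EFinM.
  over.
rewrite /=.
pose a0 := a ord0 ord0; pose b0 := b ord0 ord0.
pose A := dot a' a' / 3; pose B := dot b' b' / 3; pose C := dot a' b' / 3.
pose K := 2 * C ^+ 2 - 2 / 15 * \sum_i a' ord0 i ^+ 2 * b' ord0 i ^+ 2.
transitivity (\int[@lebesgue_measure R]_t (\1_(punctured_interval (r ord0)) t *
  (2 ^+ n * ((c ^+ 2 + A) * (d ^+ 2 + B) + 4 * c * d * C + K)
   + 2 ^+ n * (2 * c * a0 * (d ^+ 2 + B) + 2 * d * b0 * (c ^+ 2 + A)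
        + 4 * C * (c * b0 + d * a0)) * t
   + 2 ^+ n * (a0 ^+ 2 * (d ^+ 2 + B) + b0 ^+ 2 * (c ^+ 2 + A)
        + 4 * c * d * a0 * b0 + 4 * C * a0 * b0) * t ^+ 2
   + 2 ^+ n * (2 * a0 * b0 * (a0 * d + b0 * c)) * t ^+ 3
   + 2 ^+ n * (a0 ^+ 2 * b0 ^+ 2) * t ^+ 4))%:E)%E.
  apply: eq_integral => t _; congr (_ * _)%:E.
  by rewrite /quartic_mean -/A -/B -/C -/a0 -/b0 /K; ring.
rewrite integral_quartic (exprS 2 n); congr EFin.
rewrite /quartic_mean !dotS -/a' -/b' -/a0 -/b0 big_ord_recl -/a0 -/b0.
have -> : \sum_(i < n) a ord0 (lift ord0 i) ^+ 2 * b ord0 (lift ord0 i) ^+ 2 =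
    \sum_i a' ord0 i ^+ 2 * b' ord0 i ^+ 2.
  by apply: eq_bigr => i _; rewrite !mxE.
rewrite /K /A /B /C; move: (\sum__ _) (dot a' a') (dot b' b') (dot a' b').
clearbody a0 b0; clear; rewrite /= in a0 b0 *; move: (2 ^+ n) => N S X Y Z.
by field.
Qed.

End cube_moments.

(** * Linear changes of variables *)

Section linear_invariance.
Context {R : realType}.

Lemma measurable_funD_rV d (U : measurableType d) n (f g : U -> 'rV[R]_n) :
  measurable_fun setT f -> measurable_fun setT g ->
  measurable_fun setT (fun x => f x + g x).
Proof.
move=> /measurable_fun_rVP mf /measurable_fun_rVP mg.
apply/measurable_fun_rVP => i; under eq_fun do rewrite mxE.
exact: measurable_funD.
Qed.

Lemma measurable_funN_rV d (U : measurableType d) n (f : U -> 'rV[R]_n) :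
  measurable_fun setT f -> measurable_fun setT (fun x => - f x).
Proof.
move=> /measurable_fun_rVP mf.
apply/measurable_fun_rVP => i; under eq_fun do rewrite mxE.
exact: measurable_funN.
Qed.

(** The point 2 lies outside [-1, 1]: nothing is removed. *)
Definition cube n : set 'rV[R]_n := punctured_cube (fun=> 2).

Lemma cubeE n : @cube n = Binfty.
Proof.
apply/seteqP; split => x /= h i; first by have [] := h i.
split; [exact: h|apply/negP => /eqP x2; have := h i; rewrite x2; lra].
Qed.

Definition cube_indic n (x : 'rV[R]_n) : \bar R := (\1_(@cube n) x)%:E.

Lemma cube_indic_ge0 n (x : 'rV[R]_n) : (0 <= cube_indic x)%E.
Proof. by rewrite lee_fin. Qed.

Lemma measurable_cube_indic n : measurable_fun setT (@cube_indic n).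
Proof.
by apply/measurable_EFinP/measurable_indic; exact: measurable_punctured_cube.
Qed.

Lemma cube_indicN n (x : 'rV[R]_n) : cube_indic (- x) = cube_indic x.
Proof.
have H (y : 'rV[R]_n) : Binfty y -> Binfty (- y).
  by move=> h i; have := h i; rewrite mxE; lra.
congr EFin; rewrite /cube_indic cubeE !indicE; congr (nat_of_bool _)%:R.
by apply/idP/idP; rewrite !inE => /H//; rewrite opprK.
Qed.

Lemma integral_cube_indic n :
  (\int[lebesgue_rV n]_x cube_indic x = (2 ^+ n)%:E)%E.
Proof.
transitivity (\int[lebesgue_rV n]_x
   (\1_(@cube n) x * quartic 1 (0 : 'rV[R]_n) 1 (0 : 'rV[R]_n) x)%:E)%E.
  apply: eq_integral => x _; rewrite /cube_indic /quartic.
  by rewrite dot0r addr0 expr1n !mulr1.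
rewrite integral_punctured_cube /quartic_mean dot0r big1 => [|i _].
  by congr EFin; ring.
by rewrite mxE expr0n mul0r.
Qed.

(** A map [T] that turns suitable translations into any given one rescales the
    Lebesgue integral by a constant, here expressed by the mass that [T] gives
    to the cube.  This is the uniqueness of a translation-invariant measure:
    compute the double integral of [f (x + T y) * cube_indic (T y)] in both
    orders, shifting [x] by [- T y] in one of them and [y] by [S (- x)] in the
    other, and use that the cube is symmetric. *)
Lemma integral_comp_affine n (T S : 'rV[R]_n -> 'rV[R]_n)
    (f : 'rV[R]_n -> \bar R) :
  measurable_fun setT T -> (forall x y, T (y + S x) = T y + x) ->
  measurable_fun setT f -> (forall x, 0 <= f x)%E ->
  ((\int[lebesgue_rV n]_x f x) * (\int[lebesgue_rV n]_y cube_indic (T y)) =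
   (\int[lebesgue_rV n]_y f (T y)) * (2 ^+ n)%:E)%E.
Proof.
move=> mT TS mf f0.
have mfT : measurable_fun setT (f \o T) by exact: measurableT_comp.
have mcT : measurable_fun setT (@cube_indic n \o T).
  by apply: measurableT_comp => //; exact: measurable_cube_indic.
have mTsnd : measurable_fun setT (fun p : 'rV[R]_n * 'rV[R]_n => T p.2).
  exact: measurableT_comp.
have madd : measurable_fun setT (fun p : 'rV[R]_n * 'rV[R]_n => p.1 + T p.2).
  exact: (@measurable_funD_rV _ _ _ fst (fun p => T p.2)).
have mopp : measurable_fun setT (fun p : 'rV[R]_n * 'rV[R]_n => T p.2 - p.1).
  apply: (@measurable_funD_rV _ _ _ (fun p : 'rV[R]_n * 'rV[R]_n => T p.2)
           (fun p => - p.1)) => //.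
  exact: measurable_funN_rV.
rewrite -ge0_integralZl//; last 2 first.
- by move=> y _; exact: cube_indic_ge0.
- exact: integral_ge0.
transitivity (\int[lebesgue_rV n]_y \int[lebesgue_rV n]_x
    (f (x + T y)%R * cube_indic (T y)))%E.
  apply: eq_integral => y _.
  rewrite ge0_integralZr//; last 2 first.
  - apply: (measurableT_comp mf); exact: measurable_addr_rV.
  - exact: cube_indic_ge0.
  by rewrite integral_lebesgue_rV_translate.
rewrite -(@fubini_tonelli _ _ _ _ _ (lebesgue_rV n) (lebesgue_rV n)
   (fun p => f (p.1 + T p.2)%R * cube_indic (T p.2))%E); last 2 first.
- apply: emeasurable_funM.
    exact: (measurableT_comp mf).
  by apply: (measurableT_comp (@measurable_cube_indic n)).
- by move=> p; rewrite mule_ge0// cube_indic_ge0.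
transitivity (\int[lebesgue_rV n]_x \int[lebesgue_rV n]_y
    (f (T y) * cube_indic (T y - x)%R))%E.
  apply: eq_integral => x _.
  rewrite -(integral_lebesgue_rV_translate (S (- x)%R)
    (f := (fun y => f (x + T y)%R * cube_indic (T y))%E)); last 2 first.
  - apply: emeasurable_funM.
      apply: (measurableT_comp mf).
      exact: (@measurable_funD_rV _ _ _ (cst x) T).
    by apply: (measurableT_comp (@measurable_cube_indic n)).
  - by move=> y; rewrite mule_ge0// cube_indic_ge0.
  by apply: eq_integral => y _; rewrite TS addrCA subrr addr0.
rewrite (@fubini_tonelli _ _ _ _ _ (lebesgue_rV n) (lebesgue_rV n)
   (fun p => f (T p.2) * cube_indic (T p.2 - p.1)%R)%E); last 2 first.
- apply: emeasurable_funM.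
    exact: (measurableT_comp mf).
  by apply: (measurableT_comp (@measurable_cube_indic n)).
- by move=> p; rewrite mule_ge0// cube_indic_ge0.
rewrite -ge0_integralZr ?lee_fin ?exprn_ge0//.
apply: eq_integral => y _; rewrite /= ge0_integralZl//; last 2 first.
- apply: (measurableT_comp (@measurable_cube_indic n)).
  apply: (@measurable_funD_rV _ _ _ (cst (T y))
           (fun x : 'rV[R]_n => - x)) => //.
  exact: measurable_funN_rV.
- by move=> x _; exact: cube_indic_ge0.
congr (_ * _)%E.
under eq_integral => x _ do rewrite -cube_indicN opprB.
rewrite (@integral_lebesgue_rV_translate _ _ (- T y) (@cube_indic n)).
- by rewrite integral_cube_indic.
- exact: measurable_cube_indic.
- exact: cube_indic_ge0.
Qed.

(** A linear change of variables that preserves the cube has constant 1. *)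
Lemma integral_comp_cube_invariant n (T S : 'rV[R]_n -> 'rV[R]_n)
    (f : 'rV[R]_n -> \bar R) :
  measurable_fun setT T -> (forall x y, T (y + S x) = T y + x) ->
  (forall x, cube_indic (T x) = cube_indic x) ->
  measurable_fun setT f -> (forall x, 0 <= f x)%E ->
  (\int[lebesgue_rV n]_x f (T x) = \int[lebesgue_rV n]_x f x)%E.
Proof.
move=> mT TS TC mf f0.
have := integral_comp_affine mT TS mf f0.
under [X in (_ * X = _)%E -> _]eq_integral do rewrite TC.
have N0 : (2 ^+ n != 0 :> R) by rewrite expf_neq0.
rewrite integral_cube_indic => /esym; rewrite -[RHS]muleC => h.
apply/eqP; rewrite eq_le; apply/andP; split.
  rewrite -(@lee_pmul2r _ (2 ^+ n)%:E) ?lte_fin ?exprn_gt0// h muleC//.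
by rewrite -(@lee_pmul2r _ (2 ^+ n)%:E) ?lte_fin ?exprn_gt0// h muleC//.
Qed.

Lemma integral_lebesgue_rVN n (f : 'rV[R]_n -> \bar R) :
  measurable_fun setT f -> (forall x, 0 <= f x)%E ->
  (\int[lebesgue_rV n]_x f (- x)%R = \int[lebesgue_rV n]_x f x)%E.
Proof.
apply: (@integral_comp_cube_invariant _ _ (fun x => - x)).
- exact: measurable_funN_rV.
- by move=> x y; rewrite opprD opprK.
- exact: cube_indicN.
Qed.

Lemma integral_lebesgue_rV_perm n (s : 'S_n) (f : 'rV[R]_n -> \bar R) :
  measurable_fun setT f -> (forall x, 0 <= f x)%E ->
  (\int[lebesgue_rV n]_x f (col_perm s x) = \int[lebesgue_rV n]_x f x)%E.
Proof.
apply: (@integral_comp_cube_invariant _ _ (col_perm s^-1)).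
- apply/measurable_fun_rVP => i; under eq_fun do rewrite mxE.
  exact: measurable_coord_rV.
- by move=> x y; apply/rowP => i; rewrite !mxE permK.
- move=> x; rewrite /cube_indic cubeE !indicE; congr (nat_of_bool _)%:R%:E.
  apply/idP/idP; rewrite !inE => h i; last by rewrite mxE; exact: h.
  by have := h (s^-1 i)%g; rewrite mxE permKV.
Qed.

End linear_invariance.

(** * Cylinders over the facets *)

Section facets.
Context {R : realType}.

Lemma quartic_translate n c (a : 'rV[R]_n) d b theta s x :
  dot a theta = 0 -> dot b theta = 0 ->
  quartic c a d b (x + s *: theta) = quartic c a d b x.
Proof.
move=> a0 b0; rewrite /quartic !dotDl !dotZl ![dot theta _]dotC a0 b0.
by rewrite !mulr0 !addr0.
Qed.

(** The smallest [s] such that the [i]-th coordinate of [x - s theta] lies in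
    [-1, 1]; at that [s] this coordinate is [sgn theta_i]. *)
Definition entry_time n (theta : 'rV[R]_n) i (x : 'rV[R]_n) : R :=
  x ord0 i / theta ord0 i - `|theta ord0 i|^-1.

(** The cylinder in direction [theta] over the facet [y_i = sgn theta_i],
    punctured by [r]: the line through [x] meets the hyperplane that carries the
    facet at the entry time. *)
Definition facet_cylinder n (theta : 'rV[R]_n) (r : 'I_n -> R) i :
    set 'rV[R]_n :=
  [set x | punctured_cube r (x - entry_time theta i x *: theta)].

Lemma entry_timeD n (theta : 'rV[R]_n) i x s : theta ord0 i != 0 ->
  entry_time theta i (x + s *: theta) = entry_time theta i x + s.
Proof. by move=> ?; rewrite /entry_time !mxE mulrDl mulfK// addrAC. Qed.

Lemma facet_cylinderD n (theta : 'rV[R]_n) r i x s : theta ord0 i != 0 ->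
  facet_cylinder theta r i (x + s *: theta) = facet_cylinder theta r i x.
Proof.
move=> ?; rewrite /facet_cylinder /= entry_timeD//; congr (punctured_cube _ _).
by apply/rowP => j; rewrite !mxE; ring.
Qed.

Lemma measurable_entry_time n (theta : 'rV[R]_n) i :
  measurable_fun setT (entry_time theta i).
Proof.
apply: measurable_funB => //; apply: measurable_funM => //.
exact: measurable_coord_rV.
Qed.

Lemma measurable_facet_cylinder n (theta : 'rV[R]_n) r i :
  measurable (facet_cylinder theta r i).
Proof.
rewrite /facet_cylinder -[X in measurable X]setTI.
have m : measurable_fun setT
    (fun x : 'rV[R]_n => x - entry_time theta i x *: theta).
  apply: (@measurable_funD_rV _ _ _ _ id
           (fun x => - (entry_time theta i x *: theta))) => //.
  apply: measurable_funN_rV; apply/measurable_fun_rVP => j.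
  under eq_fun do rewrite mxE.
  by apply: measurable_funM => //; exact: measurable_entry_time.
by apply: m => //; exact: measurable_punctured_cube.
Qed.

Definition slab_integrand n (theta : 'rV[R]_n) (r : 'I_n -> R) i c a d b
  (x : 'rV[R]_n) : R :=
  \1_(facet_cylinder theta r i) x *
  \1_(`]0, 1]%classic : set R) (entry_time theta i x) *
  quartic c a d b x.

Lemma slab_integrand_ge0 n (theta : 'rV[R]_n) r i c (a : 'rV[R]_n) d b x :
  0 <= slab_integrand theta r i c a d b x.
Proof. by rewrite mulr_ge0 ?quartic_ge0// mulr_ge0. Qed.

Lemma measurable_slab_integrand n (theta : 'rV[R]_n) r i c (a : 'rV[R]_n) d b :
  measurable_fun setT (slab_integrand theta r i c a d b).
Proof.
apply: measurable_funM; last exact: measurable_quartic.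
apply: measurable_funM.
  by apply: measurable_indic; exact: measurable_facet_cylinder.
have m1 : measurable_fun setT (\1_(`]0, 1]%classic) : R -> R).
  exact: measurable_indic.
exact: (measurableT_comp m1 (measurable_entry_time theta i)).
Qed.

Lemma integral_unit_slab (p : R) : p != 0 ->
  (\int[@lebesgue_measure R]_t
     (\1_(`]0%R, 1%R]%classic : set R) (t / p - `|p|^-1)%R)%:E = `|p|%:E)%E.
Proof.
move=> p0.
pose A : set R := if 0 < p then `]1, 1 + p]%classic else `[-1 + p, -1[%classic.
have uA t : (`]0, 1]%classic (t / p - `|p|^-1) : Prop) = A t.
  rewrite /A; have [pp|pn|/eqP] := ltrgt0P p; last by rewrite (negbTE p0).
  - rewrite (_ : t / p - p^-1 = (t - 1) / p); last by field.
    rewrite /= !in_itv/= ltr_pdivlMr// ler_pdivrMr//.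
    by rewrite mul0r mul1r subr_gt0 lerBlDl.
  - rewrite (_ : t / p - (- p)^-1 = (- 1 - t) / (- p)); last by field.
    have Np : 0 < - p by rewrite oppr_gt0.
    rewrite /= !in_itv/= ltr_pdivlMr// ler_pdivrMr// mul0r mul1r.
    by congr (is_true _); apply/andP/andP => -[? ?]; split; lra.
transitivity (\int[@lebesgue_measure R]_t (\1_A t)%:E)%E.
  apply: eq_integral => t _; congr EFin; rewrite !indicE.
  by congr (nat_of_bool _)%:R; apply/idP/idP; rewrite !inE uA.
rewrite integral_indic//; last by rewrite /A; case: ifP.
rewrite setIT /A; case: ltrgt0P p0 => //= p0 _;
  rewrite lebesgue_measure_itv /= lte_fin.
  by rewrite ltrDl p0 -EFinB addrAC subrr add0r.
by rewrite gtrDl p0 -EFinB opprD addrA subrr add0r.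
Qed.

(** The mean of [quartic c a d b] over the facet [x_i = sgn theta_i]: the
    formula of [quartic_mean] in the other coordinates, the [i]-th one being
    absorbed in the constants. *)
Definition facet_mean n (theta : 'rV[R]_n) i c (a : 'rV[R]_n) d (b : 'rV[R]_n) :
    R :=
  let s := Num.sg (theta ord0 i) in
  let ai := a ord0 i in let bi := b ord0 i in
  ((c + s * ai) ^+ 2 + (dot a a - ai ^+ 2) / 3) *
  ((d + s * bi) ^+ 2 + (dot b b - bi ^+ 2) / 3)
  + 4 * (c + s * ai) * (d + s * bi) * ((dot a b - ai * bi) / 3)
  + 2 * ((dot a b - ai * bi) / 3) ^+ 2
  - 2 / 15 * (\sum_j a ord0 j ^+ 2 * b ord0 j ^+ 2 - ai ^+ 2 * bi ^+ 2).

(** Slice along the axis of index 0.  Translating the slice [x_0 = t] by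
    [- u t *: theta] moves it onto the facet without changing the integrand, so
    all slices contribute the same amount, for a set of [t] of length
    [|theta_0|]. *)
Lemma integral_slab_ord0 n (theta : 'rV[R]_n.+1) r c a d b :
  theta ord0 ord0 != 0 -> r ord0 = 2 -> dot a theta = 0 -> dot b theta = 0 ->
  (\int[lebesgue_rV n.+1]_x (slab_integrand theta r ord0 c a d b x)%:E =
   (`|theta ord0 ord0| * (2 ^+ n * facet_mean theta ord0 c a d b))%:E)%E.
Proof.
set p := theta ord0 ord0 => p0 r0 a0 b0.
rewrite integral_lebesgue_rVS; last 2 first.
- by apply/measurable_EFinP; exact: measurable_slab_integrand.
- by move=> x; rewrite lee_fin slab_integrand_ge0.
set a' := (uncons_rV a).2; set b' := (uncons_rV b).2.
set theta' := (uncons_rV theta).2.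
set r' := fun j => r (lift ord0 j).
have thetaE : theta = cons_rV (p, theta') by rewrite -[LHS]uncons_rVK.
pose h (v : 'rV[R]_n) := (\1_(punctured_cube r') v *
  quartic (c + Num.sg p * a ord0 ord0) a' (d + Num.sg p * b ord0 ord0) b' v)%:E.
pose u t : R := t / p - `|p|^-1.
have slice t v : (slab_integrand theta r ord0 c a d b (cons_rV (t, v)))%:E =
    ((\1_(`]0%R, 1%R]%classic : set R) (u t))%:E *
     h (v + (- u t) *: theta')%R)%E.
  have et : entry_time theta ord0 (cons_rV (t, v)) = u t.
    by rewrite /entry_time cons_rV0.
  have yE : cons_rV (t, v) + (- u t) *: theta =
      cons_rV (Num.sg p, v + (- u t) *: theta').
    rewrite {1}thetaE
      (_ : _ *: cons_rV _ = cons_rV (- u t * p, - u t *: theta')).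
      rewrite cons_rVD; congr (cons_rV (_, _)).
      transitivity (p / `|p|); first by rewrite /u; field; rewrite normr_eq0 p0.
      by rewrite {1}(numEsg p) mulfK// normr_eq0.
    apply/rowP => i; have [j ->|->] := unliftP ord0 i.
      by rewrite [LHS]mxE !cons_rVS [RHS]mxE.
    by rewrite [LHS]mxE !cons_rV0.
  rewrite /slab_integrand et -(@quartic_translate _ _ _ _ _ theta (- u t))// yE.
  rewrite -EFinM [_ * \1__ _]mulrC -mulrA; congr (_ * (_ * _))%:E; last first.
    by rewrite /quartic !dot_cons !addrA.
  rewrite !indicE; congr (nat_of_bool _)%:R.
  have e : facet_cylinder theta r ord0 (cons_rV (t, v)) =
      punctured_cube r (cons_rV (Num.sg p, v + (- u t) *: theta')).
    by rewrite /facet_cylinder /= et -scaleNr yE.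
  apply/idP/idP; rewrite !inE e.
    by move=> H j; have := H (lift ord0 j); rewrite cons_rVS.
  move=> H j; have [k ->|->] := unliftP ord0 j.
    by rewrite cons_rVS; exact: H.
  rewrite cons_rV0 r0; split.
    by case: sgrP => _; lra.
  by case: sgrP => _; apply/eqP; lra.
have mh : measurable_fun setT h by exact: measurable_indic_quartic.
have h0 v : (0 <= h v)%E by rewrite lee_fin mulr_ge0// quartic_ge0.
have hE : (\int[lebesgue_rV n]_v h v =
    (2 ^+ n * facet_mean theta ord0 c a d b)%:E)%E.
  rewrite integral_punctured_cube; congr (_ * _)%:E.
  rewrite /quartic_mean /facet_mean /= !dotS -/a' -/b' big_ord_recl.
  have -> : \sum_(i < n) a ord0 (lift ord0 i) ^+ 2 * b ord0 (lift ord0 i) ^+ 2 =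
    \sum_i a' ord0 i ^+ 2 * b' ord0 i ^+ 2.
    by apply: eq_bigr => i _; rewrite !mxE.
  rewrite -/p; move: (\sum__ _) (dot a' a') (dot b' b') (dot a' b') => S X Y Z.
  by field.
under eq_integral => t _.
  under eq_integral do rewrite slice.
  rewrite ge0_integralZl//; last 1 first.
  - by apply: (measurableT_comp mh); exact: measurable_addr_rV.
  rewrite integral_lebesgue_rV_translate// hE.
  over.
rewrite /= ge0_integralZr//; last 2 first.
- have m1 : measurable_fun setT (\1_(`]0, 1]%classic) : R -> R).
    exact: measurable_indic.
  have mu : measurable_fun [set: R] u.
    apply: measurable_funB => //; exact: mulrr_measurable.
  by apply/measurable_EFinP; exact: (measurableT_comp m1 mu).
- by rewrite -hE; exact: integral_ge0.
by rewrite integral_unit_slab.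
Qed.

Lemma dot_perm n (s : {perm 'I_n}) (x a : 'rV[R]_n) :
  dot (col_perm s x) (col_perm s a) = dot x a.
Proof.
rewrite [RHS](reindex_inj (@perm_inj _ s)) /=.
by apply: eq_bigr => i _; rewrite !mxE.
Qed.

(** Reduction to [integral_slab_ord0]: exchanging the coordinates 0 and [i]
    preserves Lebesgue measure. *)
Lemma integral_slab n (theta : 'rV[R]_n.+1) r i c a d b :
  theta ord0 i != 0 -> r i = 2 -> dot a theta = 0 -> dot b theta = 0 ->
  (\int[lebesgue_rV n.+1]_x (slab_integrand theta r i c a d b x)%:E =
   (`|theta ord0 i| * (2 ^+ n * facet_mean theta i c a d b))%:E)%E.
Proof.
move=> p0 r2 a0 b0; pose s := tperm ord0 i.
have sK (x : 'rV[R]_n.+1) : col_perm s (col_perm s x) = x.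
  by apply/rowP => j; rewrite !mxE tpermK.
have dsK (x e : 'rV[R]_n.+1) : dot (col_perm s x) e = dot x (col_perm s e).
  by rewrite -[in LHS](sK e) dot_perm.
rewrite -(integral_lebesgue_rV_perm s); last 2 first.
- by apply/measurable_EFinP; exact: measurable_slab_integrand.
- by move=> x; rewrite lee_fin slab_integrand_ge0.
have key x : slab_integrand theta r i c a d b (col_perm s x) =
    slab_integrand (col_perm s theta) (r \o s) ord0
      c (col_perm s a) d (col_perm s b) x.
  have et : entry_time theta i (col_perm s x) =
      entry_time (col_perm s theta) ord0 x.
    by rewrite /entry_time !mxE tpermR tpermL.
  rewrite /slab_integrand et; congr (_ * _ * _); last first.
    by rewrite /quartic !dsK.
  rewrite !indicE; congr (nat_of_bool _)%:R.
  apply/idP/idP; rewrite !inE /facet_cylinder /= et => H j.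
    by have := H (s j); rewrite /= !mxE tpermK.
  by have := H (s j); rewrite /= !mxE tpermK.
under eq_integral do rewrite key.
rewrite integral_slab_ord0 ?dot_perm//; last 2 first.
- by rewrite mxE tpermL.
- by rewrite /= tpermL.
rewrite mxE tpermL; congr (_ * (_ * _))%:E.
rewrite /facet_mean !dot_perm !mxE tpermL; congr (_ - _ * (_ - _)).
rewrite [RHS](reindex_inj (@perm_inj _ s)) /=.
by apply: eq_bigr => j _; rewrite !mxE.
Qed.

End facets.

(** * The facets tile the shadow of the cube *)

Section partition.
Context {R : realType}.
Variables (n : nat) (theta : 'rV[R]_n).
Implicit Types (x : 'rV[R]_n) (s : R) (i j : 'I_n).

(** The cylinder in direction [theta] over the cube: its intersection with the
    hyperplane orthogonal to [theta] is the projection of the cube. *)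
Definition shadow : set 'rV[R]_n := [set x | exists s, Binfty (x + s *: theta)].

(** The facet of index [i] loses its points [y] with [y_j = sgn theta_j] for
    some [j < i], which lie in the facet of index [j].  The indices [j] with
    [theta_j = 0] are exempt, as they have no facet in the tiling. *)
Definition puncture (i j : 'I_n) : R :=
  if (j < i)%N && (theta ord0 j != 0) then Num.sg (theta ord0 j) else 2.

Lemma coord_entry_time i x s : theta ord0 i != 0 ->
  x ord0 i - s * theta ord0 i =
  (entry_time theta i x - s) * theta ord0 i + Num.sg (theta ord0 i).
Proof.
move=> t0; have -> : Num.sg (theta ord0 i) = theta ord0 i / `|theta ord0 i|.
  by rewrite {2}(numEsg (theta ord0 i)) mulfK// normr_eq0.
by rewrite /entry_time; field; rewrite normr_eq0 t0.
Qed.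

(** As [s] grows, the [i]-th coordinate of [x - s theta] is in [-1, 1] during a
    time interval of length [2 / |theta_i|] that starts at the entry time. *)
Lemma coord_itvP i x s : theta ord0 i != 0 ->
  reflect (entry_time theta i x <= s /\
           (s - entry_time theta i x) * `|theta ord0 i| <= 2)
    (-1 <= x ord0 i - s * theta ord0 i <= 1).
Proof.
move=> t0; rewrite coord_entry_time//.
case: sgrP t0 => // t0 _; apply: (iffP andP) => -[h1 h2]; split; nra.
Qed.

Lemma facet_cylinder_shadow i x :
  facet_cylinder theta (puncture i) i x -> shadow x.
Proof.
move=> h; exists (- entry_time theta i x) => j; rewrite scaleNr.
by have [] := h j.
Qed.

(** Two facets reached from the same point have the same entry time, so that the
    point of contact lies in both, and it was removed from one of them. *)
Lemma facet_cylinder_inj i j x : theta ord0 i != 0 -> theta ord0 j != 0 ->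
  facet_cylinder theta (puncture i) i x ->
  facet_cylinder theta (puncture j) j x -> i = j.
Proof.
wlog : i j / (i <= j)%N => [H|ij] ti tj hi hj.
  have [ij|/ltnW ji] := leqP i j; first exact: H.
  by apply/esym; exact: H.
apply/val_inj/eqP; move: ij; rewrite leq_eqVlt => /orP[//|ij]; exfalso.
have := hi j; have := hj i; rewrite !mxE /puncture ij ti /=.
move=> [/(coord_itvP _ _ ti)[h1 _] /negP h2] [/(coord_itvP _ _ tj)[h3 _] _].
apply: h2; rewrite coord_entry_time//.
rewrite (_ : entry_time theta i x = entry_time theta j x).
  by rewrite subrr mul0r add0r.
by apply/eqP; rewrite eq_le h1 h3.
Qed.

(** The line enters the cube when its last coordinate enters [-1, 1], so take an
    index with the largest entry time, and the smallest such index. *)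
Lemma shadow_facet_cylinder x : theta != 0 -> shadow x ->
  exists2 i, theta ord0 i != 0 & facet_cylinder theta (puncture i) i x.
Proof.
move=> /rV0Pn[i0 t0] [s' hs]; pose s := - s'.
have {}hs j : -1 <= x ord0 j - s * theta ord0 j <= 1.
  by have := hs j; rewrite !mxE /s mulNr opprK.
pose tau := entry_time theta ^~ x.
have [k tk kmax] := @arg_maxP _ _ _ i0 (fun i => theta ord0 i != 0) tau t0.
pose last_entered i := (theta ord0 i != 0) && (tau i == tau k).
have lk : last_entered k by rewrite /last_entered tk eqxx.
have [i /andP[ti /eqP ik] imin] := arg_minnP (@nat_of_ord n) lk.
exists i => // j; rewrite !mxE.
have inside : -1 <= x ord0 j - tau i * theta ord0 j <= 1.
  have [tj0|tj] := eqVneq (theta ord0 j) 0.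
    by have := hs j; rewrite tj0 !mulr0.
  have /(coord_itvP _ _ tj)[h1 h2] := hs j.
  have /(coord_itvP _ _ ti)[h3 _] := hs i.
  apply/(coord_itvP _ _ tj); split; first by have := kmax _ tj; rewrite -ik.
  by apply: le_trans h2; rewrite ler_wpM2r// lerD2r.
split; first exact: inside.
rewrite /puncture; case: ifP => [/andP[ji tj]|_]; last first.
  by apply/negP => /eqP e; move: inside; rewrite /tau e; lra.
rewrite coord_entry_time// -subr_eq0 addrK mulf_eq0 negb_or tj andbT subr_eq0.
apply/negP => /eqP e; have := imin j.
rewrite /last_entered tj /tau e -/(tau i) ik eqxx => /(_ isT).
by rewrite leqNgt ji.
Qed.

Lemma indic_shadow x : theta != 0 ->
  \1_shadow x = \sum_(i | theta ord0 i != 0)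
    \1_(facet_cylinder theta (puncture i) i) x :> R.
Proof.
move=> t0; rewrite indicE; have [xs|xs] := boolP (x \in shadow).
  move: (xs); rewrite inE => {}xs.
  have [i ti hi] := shadow_facet_cylinder t0 xs.
  rewrite (bigD1 i)//= indicE mem_set// big1 ?addr0// => j /andP[tj ji].
  rewrite indicE memNset// => hj; move/negP : ji; apply.
  by apply/eqP; exact: facet_cylinder_inj hj hi.
rewrite big1// => i ti; rewrite indicE memNset// => /facet_cylinder_shadow h.
by move/negP : xs; apply; rewrite inE.
Qed.

Lemma measurable_shadow : theta != 0 -> measurable shadow.
Proof.
move=> t0; rewrite (_ : shadow = \bigcup_(i in [set i | theta ord0 i != 0])
  facet_cylinder theta (puncture i) i).
  by apply: fin_bigcup_measurable => // i _; exact: measurable_facet_cylinder.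
apply/seteqP; split => x.
  by move=> /(shadow_facet_cylinder t0)[i ti hi]; exists i.
by move=> [i _ /facet_cylinder_shadow].
Qed.

End partition.

(** * Integration over the hyperplane *)

Section hyperplane_integral.
Context {R : realType}.
Variables (m : nat) (theta : 'rV[R]_m.+1) (e : 'I_m -> 'rV[R]_m.+1).
Hypothesis theta1 : dot theta theta = 1.
Hypothesis e_basis : orthonormal_basis (orthogonal_hyperplane theta) e.

Lemma unit_neq0 : theta != 0.
Proof.
apply/eqP => t0; move: theta1; rewrite t0 dot0l.
by move/eqP; rewrite eq_sym oner_eq0.
Qed.

Lemma from_coordsD v w :
  from_coords e (v + w) = from_coords e v + from_coords e w.
Proof. by rewrite -big_split; apply: eq_bigr => i _; rewrite mxE scalerDl. Qed.

Lemma dot_from_coords_theta v : dot (from_coords e v) theta = 0.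
Proof.
have [eH _ _] := e_basis; rewrite dot_suml big1// => i _.
by rewrite dotZl (eH i) mulr0.
Qed.

Lemma dot_from_coords v j : dot (from_coords e v) (e j) = v ord0 j.
Proof.
have [_ eE _] := e_basis; rewrite dot_suml (bigD1 j)//= dotZl eE eqxx mulr1.
by rewrite big1 ?addr0// => i /negbTE ij; rewrite dotZl eE ij mulr0.
Qed.

Lemma measurable_from_coords : measurable_fun setT (from_coords e).
Proof.
apply/measurable_fun_rVP => j; under eq_fun do rewrite summxE.
apply: measurable_sum => i; under eq_fun do rewrite mxE.
by apply: measurable_funM => //; exact: measurable_coord_rV.
Qed.

Definition adapted_coords (x : 'rV[R]_m.+1) : 'rV[R]_m.+1 :=
  x ord0 ord0 *: theta + from_coords e (uncons_rV x).2.

Definition adapted_coords_inv (x : 'rV[R]_m.+1) : 'rV[R]_m.+1 :=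
  cons_rV (dot x theta, \row_i dot x (e i)).

Lemma adapted_coords_cons s v :
  adapted_coords (cons_rV (s, v)) = s *: theta + from_coords e v.
Proof. by rewrite /adapted_coords cons_rV0 cons_rVK. Qed.

Lemma adapted_coords_invK x : adapted_coords (adapted_coords_inv x) = x.
Proof.
rewrite adapted_coords_cons.
have [_ _ eH] := e_basis; have [|v xv] := eH (x - dot x theta *: theta).
  by rewrite /orthogonal_hyperplane /= -scaleNr dotDl dotZl theta1 mulr1 subrr.
rewrite (_ : \row_i _ = v); first by rewrite -xv addrC subrK.
apply/rowP => j; rewrite mxE -dot_from_coords -xv -scaleNr dotDl dotZl.
have [eH' _ _] := e_basis.
by rewrite [dot theta _]dotC (eH' j) mulr0 addr0.
Qed.

Lemma adapted_coordsD x y :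
  adapted_coords (y + adapted_coords_inv x) = adapted_coords y + x.
Proof.
rewrite -[in RHS](adapted_coords_invK x) /adapted_coords.
set z := adapted_coords_inv x; rewrite mxE scalerDl addrACA -from_coordsD.
by congr (_ + from_coords e _); apply/rowP => j; rewrite !mxE.
Qed.

Lemma measurable_adapted_coords : measurable_fun setT adapted_coords.
Proof.
apply: measurable_funD_rV.
  apply/measurable_fun_rVP => j; under eq_fun do rewrite mxE.
  by apply: measurable_funM => //; exact: measurable_coord_rV.
apply: (measurableT_comp measurable_from_coords).
apply/measurable_fun_rVP => j; under eq_fun do rewrite mxE.
exact: measurable_coord_rV.
Qed.

(** The constant of the change of variables [adapted_coords], up to the volume
    of the cube. *)
Definition adapted_volume : \bar R :=
  (\int[lebesgue_rV m.+1]_y cube_indic (adapted_coords y))%E.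

(** The slab of [integral_slab] sliced in direction [theta]: each line of the
    cylinder meets it in a segment of length 1, on which the integrand is
    constant. *)
Lemma integral_facet_section i c a d b :
  theta ord0 i != 0 -> dot a theta = 0 -> dot b theta = 0 ->
  ((`|theta ord0 i| * (2 ^+ m * facet_mean theta i c a d b))%:E *
     adapted_volume =
   (\int[lebesgue_rV m]_v
     (\1_(facet_cylinder theta (puncture theta i) i) (from_coords e v) *
      quartic c a d b (from_coords e v))%:E) * (2 ^+ m.+1)%:E)%E.
Proof.
move=> ti a0 b0.
set r := puncture theta i.
have ri : r i = 2 by rewrite /r /puncture ltnn.
rewrite -(integral_slab c d ti ri a0 b0).
have mF : measurable_fun setT
    (fun x => (slab_integrand theta r i c a d b x)%:E).
  by apply/measurable_EFinP; exact: measurable_slab_integrand.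
have F0 x : (0 <= (slab_integrand theta r i c a d b x)%:E)%E.
  by rewrite lee_fin slab_integrand_ge0.
rewrite (integral_comp_affine measurable_adapted_coords adapted_coordsD mF F0).
congr (_ * _)%E.
have mFT := measurableT_comp mF measurable_adapted_coords.
rewrite integral_lebesgue_rVS_swap//.
apply: eq_integral => v _.
pose tau := entry_time theta i (from_coords e v).
have slice s :
    slab_integrand theta r i c a d b (adapted_coords (cons_rV (s, v))) =
    \1_(`]0, 1]%classic : set R) (s + tau) *
    (\1_(facet_cylinder theta r i) (from_coords e v) *
     quartic c a d b (from_coords e v)).
  rewrite adapted_coords_cons addrC /slab_integrand entry_timeD//.
  rewrite quartic_translate// [tau + s]addrC.
  rewrite [X in X * quartic _ _ _ _ _]mulrC -mulrA; congr (_ * (_ * _)).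
  rewrite !indicE; congr (nat_of_bool _)%:R.
  by apply/idP/idP; rewrite !inE facet_cylinderD.
rewrite /=; under eq_integral do rewrite slice EFinM.
have m1 : measurable_fun setT (\1_(`]0, 1]%classic) : R -> R).
  exact: measurable_indic.
rewrite ge0_integralZr//; last 2 first.
- apply/measurable_EFinP; apply: (measurableT_comp m1); exact: measurable_funD.
- by rewrite lee_fin mulr_ge0// quartic_ge0.
rewrite (@integral_lebesgue_translate _ tau
  (fun s => (\1_(`]0%R, 1%R]%classic : set R) s)%:E))//; last first.
  exact/measurable_EFinP.
rewrite integral_indic// setIT /= lebesgue_measure_itv/= lte_fin ltr01.
by rewrite -EFinB subr0 mul1e.
Qed.

Lemma integral_shadow_section c a d b :
  dot a theta = 0 -> dot b theta = 0 ->
  ((2 ^+ m * \sum_i `|theta ord0 i| * facet_mean theta i c a d b)%:E *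
     adapted_volume =
   (\int[lebesgue_rV m]_v
     (\1_(shadow theta) (from_coords e v) *
      quartic c a d b (from_coords e v))%:E) * (2 ^+ m.+1)%:E)%E.
Proof.
move=> a0 b0.
have mean_ge0 i : theta ord0 i != 0 ->
    0 <= `|theta ord0 i| * (2 ^+ m * facet_mean theta i c a d b).
  move=> ti; rewrite -lee_fin.
  rewrite -(@integral_slab _ _ _ (puncture theta i) _ c _ d)//; last first.
    by rewrite /puncture ltnn.
  by apply: integral_ge0 => x _; rewrite lee_fin slab_integrand_ge0.
under eq_integral => v _.
  rewrite indic_shadow ?unit_neq0// mulr_suml -sumEFin -big_filter.
  over.
rewrite /= ge0_integral_sum//; last 2 first.
- move=> i; apply/measurable_EFinP; apply: (@measurable_funM _ _ _ _
    (fun v => \1_(facet_cylinder theta (puncture theta i) i)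
                (from_coords e v))).
    have m1 : measurable_fun setT
        (\1_(facet_cylinder theta (puncture theta i) i) : _ -> R).
      by apply: measurable_indic; exact: measurable_facet_cylinder.
    exact: (measurableT_comp m1 measurable_from_coords).
  exact: (measurableT_comp (measurable_quartic c a d b) measurable_from_coords).
- by move=> i x _; rewrite lee_fin mulr_ge0// quartic_ge0.
rewrite big_filter ge0_sume_distrl; last first.
  move=> i ti; apply: integral_ge0 => v _.
  by rewrite lee_fin mulr_ge0// quartic_ge0.
rewrite (eq_bigr (fun i =>
    (`|theta ord0 i| * (2 ^+ m * facet_mean theta i c a d b))%:E *
    adapted_volume)%E); last first.
  by move=> i ti; exact/esym/integral_facet_section.
rewrite -ge0_sume_distrl; last by move=> i ti; rewrite lee_fin mean_ge0.
congr (_ * _)%E; rewrite sumEFin mulr_sumr; congr EFin.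
rewrite [RHS]big_mkcond; apply: eq_bigr => i _; case: ifPn => [_|].
  by rewrite mulrCA.
by rewrite negbK => /eqP ->; rewrite normr0 mul0r mulr0.
Qed.

End hyperplane_integral.

(** * The uniform distribution on the projection of the cube *)

Section uniform.
Context {R : realType}.
Variables (m : nat) (theta : 'rV[R]_m.+1) (e : 'I_m -> 'rV[R]_m.+1).
Hypothesis theta1 : dot theta theta = 1.
Hypothesis e_basis : orthonormal_basis (orthogonal_hyperplane theta) e.
Variables (d : measure_display) (T : measurableType d) (P : probability T R)
  (X : {RV P >-> 'rV[R]_m.+1}).
Let K := projection_image (orthogonal_hyperplane theta) Binfty.
Hypothesis X_uniform : forall A, measurable A ->
  distribution P X A = (lebesgue_span e (A `&` K) / lebesgue_span e K)%E.

Lemma projection_image_from_coords v :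
  K (from_coords e v) <-> shadow theta (from_coords e v).
Proof.
set y := from_coords e v.
have yH : dot y theta = 0 by exact: dot_from_coords_theta.
split=> [[x Bx [_ xy]]|[s Bs]].
  exists (dot (x - y) theta); rewrite (_ : y + _ = x)//.
  set s := dot (x - y) theta.
  have w0 : dot (x - y + (- s) *: theta) theta = 0.
    by rewrite dotDl dotZl theta1 mulr1 subrr.
  (* x - y - s theta is orthogonal both to theta and to H, hence to itself *)
  suff /dot_eq0/eqP :
    dot (x - y + (- s) *: theta) (x - y + (- s) *: theta) = 0.
    by rewrite scaleNr subr_eq0 subr_eq => /eqP xE; rewrite [RHS]xE addrC.
  by rewrite {1}dotDl dotZl xy// [dot theta _]dotC w0 mulr0 addr0.
exists (y + s *: theta) => //; split=> // z zH.
by rewrite addrAC subrr add0r dotZl dotC zH mulr0.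
Qed.

Let D := from_coords e @^-1` shadow theta.

Let mD : measurable D.
Proof.
rewrite -[X in measurable X]setTI; apply: (measurable_from_coords e) => //.
exact: measurable_shadow (unit_neq0 theta1).
Qed.

Lemma lebesgue_span_shadow A : lebesgue_span e (A `&` K) =
  lebesgue_rV m (from_coords e @^-1` (A `&` shadow theta)).
Proof.
rewrite /lebesgue_span /pushforward; congr (lebesgue_rV m _).
apply/seteqP; split => v [Av Kv]; split => //.
  exact: (projection_image_from_coords v).1 Kv.
exact: (projection_image_from_coords v).2 Kv.
Qed.

(** The volume of [K] divided by itself is the total mass 1 of the distribution,
    which excludes the volumes 0 and [+oo]. *)
Lemma volume_shadow : exists2 z : R, 0 < z & lebesgue_rV m D = z%:E.
Proof.
have ZK : lebesgue_span e K = lebesgue_rV m D.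
  by have := lebesgue_span_shadow setT; rewrite !setTI.
have := X_uniform measurableT; rewrite setTI ZK probability_setT.
have : (0 <= lebesgue_rV m D)%E by exact: measure_ge0.
case: (lebesgue_rV m D) => [z|_|//].
- rewrite lee_fin le_eqVlt => /orP[/eqP <-|z0 _]; last by exists z.
  by rewrite mul0e => /eqP; rewrite eqe oner_eq0.
- by rewrite invey mule0 => /eqP; rewrite eqe oner_eq0.
Qed.

(** The distribution is carried by [shadow theta], and on the subsets of this
    set it is a multiple of the image of Lebesgue measure. *)
Lemma uniform_integral (g : 'rV[R]_m.+1 -> R) :
  measurable_fun setT g -> (forall x, 0 <= g x) ->
  (lebesgue_rV m D * \int[P]_w (g (X w))%:E =
   \int[lebesgue_rV m]_v
     (\1_(shadow theta) (from_coords e v) * g (from_coords e v))%:E)%E.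
Proof.
move=> mg g0; have [z z0 zE] := volume_shadow.
have ZK : lebesgue_span e K = z%:E.
  by have := lebesgue_span_shadow setT; rewrite !setTI => ->.
have mS := measurable_shadow (unit_neq0 theta1).
have mge : measurable_fun setT (EFin \o g) by exact/measurable_EFinP.
have me := measurable_from_coords e.
rewrite -(@ge0_integral_distribution _ _ _ _ _ _ X (EFin \o g))//.
rewrite (@ge0_negligible_integral _ _ _ _ setT (~` shadow theta))//;
  last 3 first.
- exact: measurableC.
- by move=> x _; rewrite lee_fin.
- apply: (eq_trans (X_uniform (measurableC mS))).
  by rewrite lebesgue_span_shadow setICl preimage_set0 measure0 mul0e.
rewrite setDE setCK setTI.
pose nu : {measure set 'rV[R]_m.+1 -> \bar R} :=
  pushforward (lebesgue_rV m) (from_coords e).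
have iz0 : 0 <= z^-1 by rewrite invr_ge0 ltW.
rewrite (@eq_measure_integral _ _ _ _ (mscale (NngNum iz0) (nu me)));
  last first.
  move=> A mA Ashadow; apply: (eq_trans (X_uniform mA)).
  rewrite ZK lebesgue_span_shadow setIidl//.
  by rewrite /mscale/= inver gt_eqF// muleC.
rewrite ge0_integral_mscale//; last 2 first.
- exact: measurable_funTS.
- by move=> x _; rewrite lee_fin.
rewrite zE muleA -EFinM divff ?gt_eqF// mul1e.
rewrite ge0_integral_pushforward//; last 2 first.
- exact: measurable_funTS.
- by move=> x _; rewrite lee_fin.
rewrite integral_mkcond; apply: eq_integral => v _.
by rewrite epatch_indic /= -EFinM mulrC.
Qed.

Lemma sum_norm_gt0 : 0 < \sum_i `|theta ord0 i|.
Proof.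
have /rV0Pn[i ti] := (unit_neq0 theta1).
rewrite (bigD1 i)//= ltr_pwDl ?normr_gt0//.
by apply: sumr_ge0.
Qed.

Lemma facet_mean1 i : facet_mean theta i 1 0 1 0 = 1.
Proof.
rewrite /facet_mean dot0r big1 => [|j _]; last by rewrite mxE expr0n mul0r.
by rewrite !mxE; ring.
Qed.

(** [integral_shadow_section] for the integrand 1. *)
Lemma adapted_volume_shadow z : lebesgue_rV m D = z%:E ->
  adapted_volume theta e = (2 * z / \sum_i `|theta ord0 i|)%:E.
Proof.
move=> zE; have d0 := dot0l theta.
have := integral_shadow_section theta1 e_basis 1 1 d0 d0.
have W0 := sum_norm_gt0; set W := \sum_i _ in W0 *.
under eq_bigr do rewrite facet_mean1 mulr1.
rewrite -/W; have -> : (\int[lebesgue_rV m]_v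
    (\1_(shadow theta) (from_coords e v) *
     quartic 1 0 1 0 (from_coords e v))%:E = z%:E)%E.
  rewrite -zE -[in RHS](setIT D) -integral_indic//.
  apply: eq_integral => v _; rewrite /quartic.
  by rewrite dot0r addr0 expr1n !mulr1.
have N0 : 0 < 2 ^+ m :> R by rewrite exprn_gt0.
have : (0 <= adapted_volume theta e)%E.
  by apply: integral_ge0 => y _; exact: cube_indic_ge0.
case: (adapted_volume theta e) => [v||//] _.
  rewrite -!EFinM => -[vE]; congr EFin.
  apply: (mulfI (lt0r_neq0 (mulr_gt0 N0 W0))); rewrite vE exprS.
  by field; rewrite gt_eqF.
by rewrite gt0_muley ?lte_fin ?mulr_gt0.
Qed.

(** The law of [X] is the mixture of the projected uniform laws on the facets,
    with weights proportional to [|theta_i|]. *)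
Lemma expectation_quartic c a c' b :
  dot a theta = 0 -> dot b theta = 0 ->
  (\int[P]_w (quartic c a c' b (X w))%:E =
   ((\sum_i `|theta ord0 i| * facet_mean theta i c a c' b) /
     \sum_i `|theta ord0 i|)%:E)%E.
Proof.
move=> a0 b0; have [z z0 zE] := volume_shadow.
have := integral_shadow_section theta1 e_basis c c' a0 b0.
rewrite (adapted_volume_shadow zE) -uniform_integral; last 2 first.
- exact: measurable_quartic.
- exact: quartic_ge0.
rewrite zE; have W0 := sum_norm_gt0; set W := \sum_i `|_| in W0 *.
have N0 : 0 < 2 ^+ m :> R by rewrite exprn_gt0.
have : (0 <= \int[P]_w (quartic c a c' b (X w))%:E)%E.
  by apply: integral_ge0 => y _; rewrite lee_fin quartic_ge0.
move: (\int[P]_w _)%E => [v||//] _.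
  rewrite -!EFinM => -[vE]; congr EFin.
  move: vE; rewrite exprS; set S := \sum_i _ => vE.
  have M0 : 2 * z * 2 ^+ m != 0 by rewrite !mulf_neq0 ?gt_eqF.
  apply: (mulIf M0); rewrite (_ : v * _ = z * v * (2 * 2 ^+ m)); last by ring.
  by rewrite -vE; field; rewrite gt_eqF.
by rewrite gt0_muley ?lte_fin// gt0_mulye ?lte_fin ?exprn_gt0.
Qed.

Lemma weighted_facet_mean_square i a : dot a a = 1 ->
  `|theta ord0 i| * facet_mean theta i 0 a 1 0 =
  `|theta ord0 i| * (1 / 3 + 2 / 3 * a ord0 i ^+ 2).
Proof.
move=> a1; rewrite /facet_mean !dot0r a1 big1 => [|j _]; last first.
  by rewrite mxE expr0n mulr0.
rewrite mxE; have [->|ti] := eqVneq (theta ord0 i) 0.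
  by rewrite normr0 !mul0r.
rewrite add0r exprMn sqr_sg ti mulr0 addr0 !mulr0 /=; congr (_ * _).
by field.
Qed.

(** The difference of the two sides is
    [|theta_i| (8/15 a_i^2 b_i^2 + 2/15 sum_j a_j^2 b_j^2)]. *)
Lemma weighted_facet_mean_product i a b :
  dot a a = 1 -> dot b b = 1 -> dot a b = 0 ->
  `|theta ord0 i| * facet_mean theta i 0 a 0 b <=
  `|theta ord0 i| * (1 / 9 + 2 / 9 * (a ord0 i ^+ 2 + b ord0 i ^+ 2)).
Proof.
move=> a1 b1 ab; rewrite /facet_mean a1 b1 ab.
set S := \sum_j _.
have S0 : 0 <= S by apply: sumr_ge0 => j _; rewrite mulr_ge0// sqr_ge0.
have Q0 : 0 <= a ord0 i ^+ 2 * b ord0 i ^+ 2 by rewrite mulr_ge0// sqr_ge0.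
have key s : s ^+ 2 = 1 ->
  ((0 + s * a ord0 i) ^+ 2 + (1 - a ord0 i ^+ 2) / 3) *
    ((0 + s * b ord0 i) ^+ 2 + (1 - b ord0 i ^+ 2) / 3) +
    4 * (0 + s * a ord0 i) * (0 + s * b ord0 i) *
      ((0 - a ord0 i * b ord0 i) / 3) +
    2 * ((0 - a ord0 i * b ord0 i) / 3) ^+ 2 -
    2 / 15 * (S - a ord0 i ^+ 2 * b ord0 i ^+ 2) =
  1 / 9 + 2 / 9 * (a ord0 i ^+ 2 + b ord0 i ^+ 2)
    - (8 / 15 * (a ord0 i ^+ 2 * b ord0 i ^+ 2) + 2 / 15 * S).
  move=> s1; rewrite !add0r !exprMn s1.
  rewrite (_ : 4 * _ * _ = 4 * s ^+ 2 * (a ord0 i * b ord0 i)); last by ring.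
  by rewrite s1; field.
have [->|ti] := eqVneq (theta ord0 i) 0; first by rewrite normr0 !mul0r.
rewrite key; last by rewrite sqr_sg ti.
by rewrite ler_pM2l ?normr_gt0// gerBl; lra.
Qed.

Lemma negative_correlation a b :
  dot a theta = 0 -> dot b theta = 0 ->
  dot a a = 1 -> dot b b = 1 -> dot a b = 0 ->
  (\int[P]_w (dot (X w) a ^+ 2 * dot (X w) b ^+ 2)%:E <=
   (\int[P]_w (dot (X w) a ^+ 2)%:E) * (\int[P]_w (dot (X w) b ^+ 2)%:E))%E.
Proof.
move=> a0 b0 a1 b1 ab.
have square u : dot u theta = 0 -> dot u u = 1 ->
  (\int[P]_w (dot (X w) u ^+ 2)%:E = ((\sum_i `|theta ord0 i| *
     (1 / 3 + 2 / 3 * u ord0 i ^+ 2)) / \sum_i `|theta ord0 i|)%:E)%E.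
  move=> u0 u1; under [in RHS]eq_bigr do rewrite -weighted_facet_mean_square//.
  rewrite -expectation_quartic// ?dot0l//.
  by apply: eq_integral => w _; rewrite /quartic dot0r addr0 add0r expr1n mulr1.
rewrite (square a)// (square b)//.
have -> : (\int[P]_w (dot (X w) a ^+ 2 * dot (X w) b ^+ 2)%:E =
  \int[P]_w (quartic 0 a 0 b (X w))%:E)%E.
  by apply: eq_integral => w _; rewrite /quartic !add0r.
rewrite expectation_quartic// -EFinM lee_fin.
have W0 := sum_norm_gt0; set W := \sum_i `|_| in W0 *.
pose pa := \sum_i `|theta ord0 i| * a ord0 i ^+ 2.
pose pb := \sum_i `|theta ord0 i| * b ord0 i ^+ 2.
have pa0 : 0 <= pa by apply: sumr_ge0 => i _; rewrite mulr_ge0// sqr_ge0.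
have pb0 : 0 <= pb by apply: sumr_ge0 => i _; rewrite mulr_ge0// sqr_ge0.
have sumE (u : 'rV[R]_m.+1) :
    \sum_i `|theta ord0 i| * (1 / 3 + 2 / 3 * u ord0 i ^+ 2) =
    1 / 3 * W + 2 / 3 * \sum_i `|theta ord0 i| * u ord0 i ^+ 2.
  by rewrite !mulr_sumr -big_split; apply: eq_bigr => i _ /=; ring.
rewrite !sumE -/pa -/pb.
have le_num : \sum_i `|theta ord0 i| * facet_mean theta i 0 a 0 b <=
    1 / 9 * W + 2 / 9 * (pa + pb).
  rewrite mulrDr /W /pa /pb !mulr_sumr -!big_split /=.
  apply: ler_sum => i _.
  apply: le_trans (weighted_facet_mean_product i a1 b1 ab) _.
  by rewrite le_eqVlt; apply/orP; left; apply/eqP; ring.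
apply: (@le_trans _ _ ((1 / 9 * W + 2 / 9 * (pa + pb)) / W)).
  by rewrite ler_pM2r// invr_gt0.
rewrite -subr_ge0.
have -> : (1 / 3 * W + 2 / 3 * pa) / W * ((1 / 3 * W + 2 / 3 * pb) / W) -
  (1 / 9 * W + 2 / 9 * (pa + pb)) / W = 4 / 9 * (pa * pb) / W ^+ 2.
  by field; rewrite gt_eqF.
by rewrite !mulr_ge0// invr_ge0 exprn_ge0 ?ltW.
Qed.

Lemma from_coordsN v : from_coords e (- v) = - from_coords e v.
Proof. by rewrite -sumrN; apply: eq_bigr => i _; rewrite mxE scaleNr. Qed.

Lemma indic_shadowN x : \1_(shadow theta) (- x) = \1_(shadow theta) x :> R.
Proof.
have H (y : 'rV[R]_m.+1) : shadow theta y -> shadow theta (- y).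
  move=> [s Bs]; exists (- s) => j; have := Bs j.
  by rewrite !mxE mulNr; lra.
rewrite !indicE; congr (nat_of_bool _)%:R.
by apply/idP/idP; rewrite !inE => /H; rewrite ?opprK.
Qed.

Lemma uniform_symmetric (g : 'rV[R]_m.+1 -> R) :
  measurable_fun setT g -> (forall x, 0 <= g x) ->
  (\int[P]_w (g (- X w))%:E = \int[P]_w (g (X w))%:E)%E.
Proof.
move=> mg g0; have [z z0 zE] := volume_shadow.
have mgN : measurable_fun setT (fun x : 'rV[R]_m.+1 => g (- x)).
  by apply: (measurableT_comp mg); exact: measurable_funN_rV.
have me := measurable_from_coords e.
pose f (v : 'rV[R]_m) :=
  (\1_(shadow theta) (from_coords e v) * g (from_coords e v))%:E.
have mf : measurable_fun setT f.
  apply/measurable_EFinP; apply: measurable_funM; last first.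
    exact: (measurableT_comp mg me).
  have m1 : measurable_fun setT (\1_(shadow theta) : _ -> R).
    by apply: measurable_indic; exact: measurable_shadow (unit_neq0 theta1).
  exact: (measurableT_comp m1 me).
have zI : (z%:E * \int[P]_w (g (- X w))%:E = z%:E * \int[P]_w (g (X w))%:E)%E.
  rewrite -zE (uniform_integral mgN)// uniform_integral//.
  rewrite -(integral_lebesgue_rVN mf); last first.
    by move=> v; rewrite lee_fin mulr_ge0.
  by apply: eq_integral => v _; rewrite /f from_coordsN indic_shadowN.
by rewrite -[LHS]mul1e -[RHS]mul1e -(mulVf (lt0r_neq0 z0)) EFinM -!muleA zI.
Qed.

(** The coordinates of a projected point are bounded by its Euclidean norm,
    hence by that of a point of the cube. *)
Lemma coord_shadow_bound v i : shadow theta (from_coords e v) ->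
  from_coords e v ord0 i <= m.+1%:R.
Proof.
set x := from_coords e v => -[s Bs].
have xH : dot x theta = 0 by exact: dot_from_coords_theta.
have le1 : x ord0 i ^+ 2 <= dot x x.
  rewrite /dot (bigD1 i)//= -expr2 lerDl.
  by apply: sumr_ge0 => j _; rewrite -expr2 sqr_ge0.
have le2 : dot x x <= dot (x + s *: theta) (x + s *: theta).
  rewrite dotDl dotZl ![dot _ (x + _)]dotC !dotDl !dotZl theta1 xH.
  by rewrite [dot theta x]dotC xH mulr0 addr0 add0r mulr1 lerDl -expr2 sqr_ge0.
have le3 : dot (x + s *: theta) (x + s *: theta) <= m.+1%:R.
  apply: (@le_trans _ _ (\sum_(j < m.+1) 1)); last first.
    by rewrite sumr_const card_ord.
  by apply: ler_sum => j _; have := Bs j; nra.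
have N1 : 1 <= m.+1%:R :> R by rewrite ler1n.
by have := le_trans le1 (le_trans le2 le3); nra.
Qed.

(** By symmetry the positive and the negative part of a coordinate have the same
    expectation, and it is finite since [K] is bounded. *)
Lemma uniform_centered : centered X.
Proof.
move=> i; pose g (x : 'rV[R]_m.+1) : R := Num.max (x ord0 i) 0.
have mg : measurable_fun setT g.
  by apply: measurable_maxr => //; exact: measurable_coord_rV.
have g0 x : 0 <= g x by rewrite le_max lexx orbT.
rewrite unlock integralE.
have -> : (\int[P]_w ((fun w => (X w ord0 i)%:E)^\+ w) =
    \int[P]_w (g (X w))%:E)%E.
  by apply: eq_integral => w _; rewrite funeposE /g EFin_max.
have -> : (\int[P]_w ((fun w => (X w ord0 i)%:E)^\- w) =
    \int[P]_w (g (- X w))%:E)%E.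
  by apply: eq_integral => w _; rewrite funenegE /g EFin_max mxE.
rewrite uniform_symmetric// subee// ge0_fin_numE; last first.
  by apply: integral_ge0 => w _; rewrite lee_fin.
have [z z0 zE] := volume_shadow.
have : (z%:E * \int[P]_w (g (X w))%:E <= z%:E * \int[P]_w (m.+1%:R)%:E)%E.
  have me := measurable_from_coords e.
  have m1 : measurable_fun setT (\1_(shadow theta) : _ -> R).
    by apply: measurable_indic; exact: measurable_shadow (unit_neq0 theta1).
  rewrite -zE uniform_integral// (@uniform_integral (cst m.+1%:R))//.
  apply: ge0_le_integral => //.
  - by move=> v _; rewrite lee_fin mulr_ge0.
  - apply/measurable_EFinP; apply: measurable_funM; last first.
      exact: (measurableT_comp mg me).
    exact: (measurableT_comp m1 me).
  - apply/measurable_EFinP; apply: measurable_funM => //.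
    exact: (measurableT_comp m1 me).
  move=> v _; rewrite lee_fin indicE.
  have [|_] := boolP (from_coords e v \in shadow theta); last first.
    by rewrite !mul0r.
  by rewrite inE !mul1r => vs; rewrite /g ge_max coord_shadow_bound//=.
rewrite integral_cst//= [X in (_ * (_ * X))%E](probability_setT P) mule1.
rewrite lee_pmul2l ?lte_fin// => h.
exact: le_lt_trans h (ltry _).
Qed.

End uniform.

(** * Square negative correlation *)

Theorem theorem3p2 (R : realType) (n : nat) (theta : 'rV[R]_n)
  (d : measure_display) (T : measurableType d) (P : probability T R)
  (X : {RV P >-> 'rV[R]_n}) :
  unit_sphere theta ->
  let H := orthogonal_hyperplane theta in
  let K := projection_image H Binfty in
  uniformly_distributed n.-1 H K X ->
  (forall eta1 eta2 : 'rV[R]_n,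
      H eta1 -> H eta2 -> enorm eta1 = 1 -> enorm eta2 = 1 ->
      dot eta1 eta2 = 0 ->
      ('E_P[fun w => (dot (X w) eta1 ^+ 2 * dot (X w) eta2 ^+ 2)%R]
       <= 'E_P[fun w => (dot (X w) eta1 ^+ 2)%R]
          * 'E_P[fun w => (dot (X w) eta2 ^+ 2)%R])%E)
  /\
  (forall (m : nat) (eta : 'I_m -> 'rV[R]_n),
      orthonormal_basis H eta -> square_negative_correlation X eta).
Proof.
case: n theta X => [|m] theta X.
  rewrite /unit_sphere /= /enorm /dot big_ord0 sqrtr0 => /eqP.
  by rewrite eq_sym oner_eq0.
move=> theta1 H K [e e_basis X_uniform].
have unit_dot (x : 'rV[R]_m.+1) : enorm x = 1 -> dot x x = 1.
  by move=> x1; rewrite -[LHS]sqr_sqrtr ?dot_ge0// -/(enorm x) x1 expr1n.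
have correlation (a b : 'rV[R]_m.+1) :
    H a -> H b -> dot a a = 1 -> dot b b = 1 -> dot a b = 0 ->
    ('E_P[fun w => (dot (X w) a ^+ 2 * dot (X w) b ^+ 2)%R]
     <= 'E_P[fun w => (dot (X w) a ^+ 2)%R] *
        'E_P[fun w => (dot (X w) b ^+ 2)%R])%E.
  move=> aH bH a1 b1 ab; rewrite unlock.
  exact: (negative_correlation (unit_dot _ theta1) e_basis X_uniform).
split=> [a b aH bH /unit_dot a1 /unit_dot b1|k eta [etaH etaE _]].
  exact: correlation.
split; first exact: (uniform_centered (unit_dot _ theta1) e_basis X_uniform).
move=> i j ij; apply: correlation; rewrite ?etaE ?eqxx//; try exact: etaH.
by rewrite (negbTE ij).
Qed.
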